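(* Let $X$ be a finite-dimensional (real or complex) CL-space with an absolute norm and let $m$ be a positive integer. If $y_1,\dots,y_m$ are extreme points of $B_X$ all of whose coordinates are nonnegative real numbers, then $\frac1m\sum_{j=1}^my_j\in\tilde\rho\,\mathcal{P}({}^mX)$; that is, there is a nonzero $Q\in\mathcal{P}({}^mX)$ which strongly attains its norm at $\frac1m\sum_{j=1}^my_j$.
   Context: $X$ is $\mathbb{F}^n$ ($\mathbb{F}=\mathbb{R}$ or $\mathbb{C}$) with a norm that is absolute: $\|(a_1,\dots,a_n)\|=\|(|a_1|,\dots,|a_n|)\|$ and $\|e_j\|=1$ for the canonical basis vectors. A Banach space is a CL-space if its unit ball is the absolutely convex hull of every maximal convex subset of its unit sphere; in finite dimensions, equivalently, $|x^*(x)|=1$ for every extreme point $x^*$ of $B_{X^*}$ and every extreme point $x$ of $B_X$. $\mathcal{P}({}^mX)$ is the space of $m$-homogeneous scalar polynomials on $X$ with norm $\|Q\|=\sup_{x\in B_X}|Q(x)|$. A nonzero $Q$ strongly attains its norm at $x\in B_X$ if for every sequence $\{x_n\}\subset B_X$ with $|Q(x_n)|\to\|Q\|$ there are a scalar $\lambda$ with $|\lambda|=1$ and a subsequence of $\{x_n\}$ converging to $\lambda x$; $\tilde\rho\,\mathcal{P}({}^mX)$ is the set of all points at which some nonzero element of $\mathcal{P}({}^mX)$ strongly attains its norm. *)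

(* Defs.v *)
From Stdlib Require Import Reals List.
Open Scope R_scope.

Inductive fld := FR | FC.

Definition C : Type := (R * R)%type.
Definition Cadd (z w : C) : C := (fst z + fst w, snd z + snd w).
Definition Cmul (z w : C) : C :=
  (fst z * fst w - snd z * snd w, fst z * snd w + snd z * fst w).
Definition Copp (z : C) : C := (- fst z, - snd z).
Definition Cmod (z : C) : R := sqrt (fst z ^ 2 + snd z ^ 2).

Definition K (k : fld) : Type := match k with FR => R | FC => C end.
Definition Kadd (k : fld) : K k -> K k -> K k :=
  match k with FR => Rplus | FC => Cadd end.
Definition Kmul (k : fld) : K k -> K k -> K k :=
  match k with FR => Rmult | FC => Cmul end.
Definition Kopp (k : fld) : K k -> K k :=
  match k with FR => Ropp | FC => Copp end.
Definition Kabs (k : fld) : K k -> R :=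
  match k with FR => Rabs | FC => Cmod end.
Definition Kof (k : fld) : R -> K k :=
  match k with FR => fun r => r | FC => fun r => (r, 0) end.
Definition K0 (k : fld) : K k := Kof k 0.
Definition K1 (k : fld) : K k := Kof k 1.

Fixpoint Ksum (k : fld) (f : nat -> K k) (n : nat) : K k :=
  match n with O => K0 k | S p => Kadd k (Ksum k f p) (f p) end.
Definition Kprod (k : fld) (l : list (K k)) : K k :=
  fold_right (Kmul k) (K1 k) l.

(** Vectors of F^n are represented as maps nat -> F vanishing from index n on. *)
Definition vec (k : fld) : Type := nat -> K k.
Definition inX (k : fld) (n : nat) (x : vec k) : Prop :=
  forall i, (n <= i)%nat -> x i = K0 k.
Definition vadd (k : fld) (x y : vec k) : vec k := fun i => Kadd k (x i) (y i).
Definition vscal (k : fld) (a : K k) (x : vec k) : vec k := fun i => Kmul k a (x i).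
Definition vsub (k : fld) (x y : vec k) : vec k := fun i => Kadd k (x i) (Kopp k (y i)).
Definition evec (k : fld) (j : nat) : vec k :=
  fun i => if Nat.eqb i j then K1 k else K0 k.
Definition vabs (k : fld) (x : vec k) : vec k := fun i => Kof k (Kabs k (x i)).

Definition is_norm (k : fld) (n : nat) (N : vec k -> R) : Prop :=
  (forall x, inX k n x -> 0 <= N x) /\
  (forall x, inX k n x -> N x = 0 -> x = (fun _ => K0 k)) /\
  (forall a x, inX k n x -> N (vscal k a x) = Kabs k a * N x) /\
  (forall x y, inX k n x -> inX k n y -> N (vadd k x y) <= N x + N y).

Definition absolute_norm (k : fld) (n : nat) (N : vec k -> R) : Prop :=
  is_norm k n N /\
  (forall x, inX k n x -> N x = N (vabs k x)) /\
  (forall j, (j < n)%nat -> N (evec k j) = 1).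

Definition in_ball (k : fld) (n : nat) (N : vec k -> R) (x : vec k) : Prop :=
  inX k n x /\ N x <= 1.

Definition vconv (k : fld) (t : R) (y z : vec k) : vec k :=
  vadd k (vscal k (Kof k t) y) (vscal k (Kof k (1 - t)) z).

Definition extreme_ball (k : fld) (n : nat) (N : vec k -> R) (x : vec k) : Prop :=
  in_ball k n N x /\
  forall y z t, in_ball k n N y -> in_ball k n N z -> 0 < t < 1 ->
    x = vconv k t y z -> y = z.

(** Linear functionals on F^n: x* (x) = sum_i a_i x_i, a in F^n. *)
Definition pair (k : fld) (n : nat) (a x : vec k) : K k :=
  Ksum k (fun i => Kmul k (a i) (x i)) n.

Definition in_dual_ball (k : fld) (n : nat) (N : vec k -> R) (a : vec k) : Prop :=
  inX k n a /\ forall x, in_ball k n N x -> Kabs k (pair k n a x) <= 1.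

Definition extreme_dual_ball (k : fld) (n : nat) (N : vec k -> R) (a : vec k) : Prop :=
  in_dual_ball k n N a /\
  forall b c t, in_dual_ball k n N b -> in_dual_ball k n N c -> 0 < t < 1 ->
    a = vconv k t b c -> b = c.

(** finite-dimensional characterisation of CL-spaces *)
Definition CL_space (k : fld) (n : nat) (N : vec k -> R) : Prop :=
  forall a x, extreme_dual_ball k n N a -> extreme_ball k n N x ->
    Kabs k (pair k n a x) = 1.

(** m-homogeneous polynomials on F^n: finite sums of c * x_{i_1} ... x_{i_m} *)
Definition poly_eval (k : fld) (L : list (K k * list nat)) (x : vec k) : K k :=
  fold_right (fun p acc => Kadd k (Kmul k (fst p) (Kprod k (map x (snd p)))) acc)
    (K0 k) L.

Definition is_mhomog (k : fld) (n m : nat) (Q : vec k -> K k) : Prop :=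
  exists L : list (K k * list nat),
    (forall p, In p L -> length (snd p) = m /\ forall i, In i (snd p) -> (i < n)%nat) /\
    (forall x, inX k n x -> Q x = poly_eval k L x).

Definition poly_norm (k : fld) (n : nat) (N : vec k -> R) (Q : vec k -> K k) (M : R) : Prop :=
  is_lub (fun r => exists x, in_ball k n N x /\ r = Kabs k (Q x)) M.

Definition strongly_attains (k : fld) (n : nat) (N : vec k -> R)
    (Q : vec k -> K k) (x : vec k) : Prop :=
  (exists z, inX k n z /\ Q z <> K0 k) /\
  in_ball k n N x /\
  exists M, poly_norm k n N Q M /\
    forall xs : nat -> vec k,
      (forall j, in_ball k n N (xs j)) ->
      Un_cv (fun j => Kabs k (Q (xs j))) M ->
      exists (lam : K k) (phi : nat -> nat),
        Kabs k lam = 1 /\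
        (forall a b, (a < b)%nat -> (phi a < phi b)%nat) /\
        Un_cv (fun j => N (vsub k (xs (phi j)) (vscal k lam x))) 0.

Definition in_rho_tilde (k : fld) (n m : nat) (N : vec k -> R) (x : vec k) : Prop :=
  exists Q, is_mhomog k n m Q /\ strongly_attains k n N Q x.

Definition vavg (k : fld) (m : nat) (y : nat -> vec k) : vec k :=
  fun i => Kmul k (Kof k (/ INR m)) (Ksum k (fun j => y j i) m).

Definition nonneg_real_coords (k : fld) (n : nat) (x : vec k) : Prop :=
  forall i, (i < n)%nat -> exists r, 0 <= r /\ x i = Kof k r.

(* Main.v *)
(** For each coordinate [i], maximising the strictly convex function
    [sum_l |a_l|^2] over the dual vectors [a] with [|a_i| = 1] produces an extreme
    point of the dual ball, and every vector with the same moduli [r^i_l = |a_l|]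
    is again extreme.  Flipping signs in the CL condition shows that [r^i] and
    each [y_j] have supports meeting in a single coordinate [s_i(j)], where both
    equal 1.  With [c_l = sum_i r^i_l > 0], take
    [Q(x) = sum_i prod_j x_{s_i(j)} + (sum_l c_l x_l)^m].
    On the ball [sum_l r^i_l |x_l| <= 1], so by AM-GM the i-th monomial is maximal
    only if [|x_i|] is the i-th coordinate of the average of the [y_j], while
    [|sum_l c_l x_l| <= n] with equality there only if the coordinates of [x] have
    a common phase.  Hence [|Q|] is maximal exactly at the unimodular multiples of
    the average, and compactness of the ball upgrades this to strong attainment. *)
Require Import Defs.
From Stdlib Require Import Reals List Lra Lia Arith.
From Stdlib Require Import Classical IndefiniteDescription FunctionalExtensionality.
Open Scope R_scope.

(** * Finite real sums and products *)

Fixpoint rsum (f : nat -> R) (n : nat) : R :=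
  match n with O => 0 | S p => rsum f p + f p end.
Fixpoint rprod (f : nat -> R) (n : nat) : R :=
  match n with O => 1 | S p => rprod f p * f p end.

Lemma rsum_ext f g n :
  (forall i, (i < n)%nat -> f i = g i) -> rsum f n = rsum g n.
Proof.
  induction n as [|n IH]; simpl; intros H; auto.
  rewrite IH, (H n); auto with arith.
Qed.

Lemma rprod_ext f g n :
  (forall i, (i < n)%nat -> f i = g i) -> rprod f n = rprod g n.
Proof.
  induction n as [|n IH]; simpl; intros H; auto.
  rewrite IH, (H n); auto with arith.
Qed.

Lemma rsum_le f g n :
  (forall i, (i < n)%nat -> f i <= g i) -> rsum f n <= rsum g n.
Proof.
  induction n as [|n IH]; simpl; intros H; [lra|].
  assert (rsum f n <= rsum g n) by (apply IH; auto with arith).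
  assert (f n <= g n) by auto with arith.
  lra.
Qed.

(** The gaps [g i - f i] are nonnegative with total at most 0, so each vanishes. This is the device
    that turns an equality of totals into termwise equalities. *)
Lemma rsum_le_eq f g n :
  (forall i, (i < n)%nat -> f i <= g i) -> rsum g n <= rsum f n ->
  forall i, (i < n)%nat -> f i = g i.
Proof.
  induction n as [|n IH]; simpl; intros H E i Hi; [lia|].
  assert (rsum f n <= rsum g n) by (apply rsum_le; auto with arith).
  assert (f n <= g n) by auto with arith.
  destruct (Nat.eq_dec i n) as [->|]; [lra|].
  apply IH; [auto with arith | lra | lia].
Qed.

Lemma rsum_const c n : rsum (fun _ => c) n = INR n * c.
Proof.
  induction n as [|n IH]; [simpl; ring|].
  rewrite S_INR; simpl; rewrite IH; ring.
Qed.

Lemma rprod_const c n : rprod (fun _ => c) n = c ^ n.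
Proof. induction n as [|n IH]; simpl; [|rewrite IH]; ring. Qed.

Lemma rsum_plus f g n :
  rsum (fun i => f i + g i) n = rsum f n + rsum g n.
Proof. induction n as [|n IH]; simpl; [|rewrite IH]; ring. Qed.

Lemma rsum_scal c f n : rsum (fun i => c * f i) n = c * rsum f n.
Proof. induction n as [|n IH]; simpl; [|rewrite IH]; ring. Qed.

Lemma rprod_mult f g n :
  rprod (fun i => f i * g i) n = rprod f n * rprod g n.
Proof. induction n as [|n IH]; simpl; [|rewrite IH]; ring. Qed.

Lemma rsum_swap (f : nat -> nat -> R) m n :
  rsum (fun i => rsum (fun j => f i j) n) m =
  rsum (fun j => rsum (fun i => f i j) m) n.
Proof.
  induction m as [|m IH]; simpl.
  - rewrite rsum_const; ring.
  - rewrite IH, <- rsum_plus; reflexivity.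
Qed.

Lemma rsum_nonneg f n : (forall i, (i < n)%nat -> 0 <= f i) -> 0 <= rsum f n.
Proof.
  intros H; replace 0 with (rsum (fun _ => 0) n) by (rewrite rsum_const; ring).
  now apply rsum_le.
Qed.

Lemma rsum_term_le f n i :
  (forall i, (i < n)%nat -> 0 <= f i) -> (i < n)%nat -> f i <= rsum f n.
Proof.
  induction n as [|n IH]; simpl; intros H Hi; [lia|].
  assert (0 <= f n) by auto with arith.
  destruct (Nat.eq_dec i n) as [->|].
  - assert (0 <= rsum f n) by (apply rsum_nonneg; auto with arith). lra.
  - assert (f i <= rsum f n) by (apply IH; [auto with arith | lia]). lra.
Qed.

Lemma rsum_single f n i :
  (i < n)%nat -> (forall l, (l < n)%nat -> l <> i -> f l = 0) -> rsum f n = f i.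
Proof.
  induction n as [|n IH]; simpl; intros Hi H; [lia|].
  destruct (Nat.eq_dec i n) as [->|].
  - rewrite (rsum_ext f (fun _ => 0)), rsum_const; [ring|].
    intros l Hl; apply H; lia.
  - rewrite IH, (H n); try lia; [ring|]. intros; apply H; lia.
Qed.

Lemma rsum_update f g n i :
  (i < n)%nat -> (forall l, l <> i -> g l = f l) ->
  rsum g n = rsum f n + (g i - f i).
Proof.
  intros Hi H.
  rewrite <- (rsum_single (fun l => g l - f l) n i Hi), <- rsum_plus.
  - apply rsum_ext; intros; ring.
  - intros l _ Hl; rewrite (H l Hl); ring.
Qed.

Lemma rprod_pos f n : (forall i, (i < n)%nat -> 0 < f i) -> 0 < rprod f n.
Proof.
  induction n as [|n IH]; simpl; intros H; [lra|].
  apply Rmult_lt_0_compat; auto with arith.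
Qed.

Lemma rprod_nonneg f n : (forall i, (i < n)%nat -> 0 <= f i) -> 0 <= rprod f n.
Proof.
  induction n as [|n IH]; simpl; intros H; [lra|].
  apply Rmult_le_pos; auto with arith.
Qed.

(** If the last term is 0, induction finds the index; if it is 1, the earlier terms are nonnegative
    with sum 0, so all vanish. *)
Lemma zero_one_sum f n :
  (forall i, (i < n)%nat -> f i = 0 \/ f i = 1) -> rsum f n = 1 ->
  exists s, (s < n)%nat /\ f s = 1 /\ forall i, (i < n)%nat -> i <> s -> f i = 0.
Proof.
  induction n as [|n IH]; simpl; intros H E; [lra|].
  destruct (H n) as [H0|H1]; auto with arith.
  - destruct IH as (s & Hs & Hs1 & Hs0); [auto with arith | lra |].
    exists s; repeat split; auto with arith.
    intros i Hi His; destruct (Nat.eq_dec i n) as [->|]; auto.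
    apply Hs0; lia.
  - exists n; repeat split; auto with arith.
    intros i Hi Hin; symmetry.
    apply (rsum_le_eq (fun _ => 0) f n); try lia.
    + intros l Hl; destruct (H l); [lia | lra | lra].
    + rewrite rsum_const; lra.
Qed.

(** * The arithmetic-geometric mean inequality *)

(** Pólya's route to AM-GM: multiply the bounds [z j <= exp (z j - 1)], each of which is strict
    unless [z j = 1]. *)
Lemma rprod_le_exp z n :
  (forall j, (j < n)%nat -> 0 <= z j) ->
  rprod z n <= exp (rsum (fun j => z j - 1) n) /\
  (rprod z n = exp (rsum (fun j => z j - 1) n) ->
   forall j, (j < n)%nat -> z j = 1).
Proof.
  induction n as [|n IH]; simpl; intros H.
  - rewrite exp_0; split; [lra | intros; lia].
  - destruct IH as [IH1 IH2]; [auto with arith|].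
    rewrite exp_plus.
    assert (P := rprod_nonneg z n ltac:(auto with arith)).
    assert (Z : 0 <= z n) by auto with arith.
    assert (E1 := exp_pos (rsum (fun j => z j - 1) n)).
    assert (E2 := exp_pos (z n - 1)).
    assert (D : z n = 1 \/ z n < exp (z n - 1)).
    { destruct (Req_dec (z n) 1); [auto|right].
      assert (1 + (z n - 1) < exp (z n - 1)) by (apply exp_ineq1; lra). lra. }
    set (A := rprod z n) in *. set (B := exp (rsum _ n)) in *.
    set (e := exp (z n - 1)) in *.
    assert (Hle : z n <= e).
    { destruct D as [D|D]; [|lra]. unfold e; rewrite D.
      replace (1 - 1) with 0 by ring; rewrite exp_0; lra. }
    split; [nra|].
    intros E.
    (* A strict last factor would give [A * z n <= B * z n < B * e], since [A <= B] and [B > 0]. *)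
    assert (Hz : z n = 1) by (destruct D; [auto | nra]).
    intros j Hj; destruct (Nat.eq_dec j n) as [->|]; auto.
    apply IH2; [|lia].
    assert (e = 1).
    { unfold e; rewrite Hz; replace (1 - 1) with 0 by ring; apply exp_0. }
    nra.
Qed.

(** AM-GM normalised to mean at most 1: the exponent in the previous bound is then at most 0, and
    product 1 forces equality there. *)
Lemma rprod_le_1 z n :
  (forall j, (j < n)%nat -> 0 <= z j) -> rsum z n <= INR n ->
  rprod z n <= 1 /\
  (rprod z n = 1 -> forall j, (j < n)%nat -> z j = 1).
Proof.
  intros H S.
  destruct (rprod_le_exp z n H) as [L E].
  assert (X : rsum (fun j => z j - 1) n = rsum z n - INR n).
  { unfold Rminus at 1; rewrite rsum_plus, rsum_const; ring. }
  assert (exp (rsum (fun j => z j - 1) n) <= 1).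
  { rewrite X, <- exp_0.
    destruct (Rle_lt_or_eq_dec _ _ S) as [S'|S'].
    - left; apply exp_increasing; lra.
    - rewrite S'; right; f_equal; ring. }
  split; [lra|]. intros P; apply E; lra.
Qed.

(* The monomial [x_{s 0} ... x_{s (m-1)}] on the simplex [sum_l r_l x_l <= 1]:
   [r_l * m * h_l] is the number of [j] with [s j = l], so AM-GM applied to the
   ratios [x_{s j} / h_{s j}] singles out [h]. *)
Lemma monomial_max (m n : nat) (u : nat -> nat -> R) (r h x : nat -> R)
    (s : nat -> nat) :
  (1 <= m)%nat ->
  (forall j l, (j < m)%nat -> (l < n)%nat -> 0 <= u j l <= 1) ->
  (forall l, (l < n)%nat -> 0 <= r l <= 1) ->
  (forall l, (l < n)%nat -> h l = / INR m * rsum (fun j => u j l) m) ->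
  (forall j, (j < m)%nat -> (s j < n)%nat /\ r (s j) * u j (s j) = 1 /\
     forall l, (l < n)%nat -> l <> s j -> r l * u j l = 0) ->
  (forall l, (l < n)%nat -> 0 <= x l) ->
  rsum (fun l => r l * x l) n <= 1 ->
  rprod (fun j => x (s j)) m <= rprod (fun j => h (s j)) m /\
  (rprod (fun j => x (s j)) m = rprod (fun j => h (s j)) m ->
   forall l, (l < n)%nat -> 0 < r l -> x l = h l).
Proof.
  intros Hm Hu Hr Hh Hs Hx Hsum.
  assert (Pm : 0 < INR m) by (apply lt_0_INR; lia).
  assert (Hh0 : forall l, (l < n)%nat -> 0 <= h l).
  { intros l Hl; rewrite Hh by auto. apply Rmult_le_pos.
    - left; now apply Rinv_0_lt_compat.
    - apply rsum_nonneg; intros j Hj; now apply Hu. }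
  (* Two numbers in [0,1] whose product is 1 are both 1. *)
  assert (Hus : forall j, (j < m)%nat -> u j (s j) = 1 /\ r (s j) = 1).
  { intros j Hj; destruct (Hs j Hj) as (H1 & H2 & _).
    assert (A := Hu j (s j) Hj H1). assert (B := Hr (s j) H1). split; nra. }
  assert (Hhs : forall j, (j < m)%nat -> 0 < h (s j)).
  { intros j Hj; destruct (Hs j Hj) as (H1 & _).
    rewrite Hh by auto. apply Rmult_lt_0_compat.
    - now apply Rinv_0_lt_compat.
    - destruct (Hus j Hj) as [E _].
      assert (u j (s j) <= rsum (fun j0 => u j0 (s j)) m).
      { apply (rsum_term_le (fun j0 => u j0 (s j))); auto.
        intros i Hi; now apply Hu. }
      lra. }
  set (z := fun j => x (s j) * / h (s j)).
  assert (Hz0 : forall j, (j < m)%nat -> 0 <= z j).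
  { intros j Hj; apply Rmult_le_pos.
    - apply Hx, Hs, Hj.
    - left; apply Rinv_0_lt_compat; auto. }
  (* Since [r l * u j l] is 1 at [l = s j] and 0 elsewhere, [z j] equals the sum over [l] of
     [r l * u j l * (x l * / h l)]. Exchanging the sums produces the factor [INR m * h l]. *)
  assert (Sz : rsum z m = INR m * rsum (fun l => r l * (x l * / h l) * h l) n).
  { rewrite (rsum_ext z
      (fun j => rsum (fun l => r l * u j l * (x l * / h l)) n)).
    2:{ intros j Hj; destruct (Hs j Hj) as (H1 & H2 & H3).
        rewrite (rsum_single _ n (s j) H1).
        - rewrite H2; unfold z; ring.
        - intros l Hl Hne; rewrite H3; auto; ring. }
    rewrite rsum_swap, <- rsum_scal.
    apply rsum_ext; intros l Hl.
    rewrite (rsum_ext _ (fun j => (r l * (x l * / h l)) * u j l))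
      by (intros; ring).
    rewrite rsum_scal.
    replace (rsum (fun j => u j l) m) with (INR m * h l)
      by (rewrite (Hh l Hl); field; lra).
    ring. }
  (* Equality holds where [h l > 0]. Where [h l = 0] the left side is 0 whatever value [/ 0] takes,
     so only an inequality is available. *)
  assert (Hterm : forall l, (l < n)%nat -> r l * (x l * / h l) * h l <= r l * x l).
  { intros l Hl. destruct (Rle_lt_or_eq_dec _ _ (Hh0 l Hl)) as [P|P].
    - right; field; lra.
    - rewrite <- P. assert (A := Hr l Hl). assert (B := Hx l Hl). nra. }
  assert (Sle := rsum_le _ _ n Hterm).
  destruct (rprod_le_1 z m Hz0) as [L E]; [rewrite Sz; nra|].
  assert (Ph := rprod_pos _ m Hhs).
  assert (Fac : rprod (fun j => x (s j)) m = rprod z m * rprod (fun j => h (s j)) m).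
  { rewrite <- rprod_mult; apply rprod_ext; intros j Hj; unfold z.
    field. specialize (Hhs j Hj); lra. }
  split; [rewrite Fac; nra|].
  intros Q.
  assert (Z1 : forall j, (j < m)%nat -> z j = 1) by (apply E; nra).
  assert (Sm : rsum z m = INR m).
  { rewrite (rsum_ext z (fun _ => 1)), rsum_const by auto; ring. }
  (* All ratios being 1, the sum in [Sz] equals 1, which is also the upper bound for the sum of the
     [r l * x l]; hence no term of [Hterm] is strict. *)
  assert (Teq : forall l, (l < n)%nat -> r l * (x l * / h l) * h l = r l * x l).
  { apply rsum_le_eq; auto. nra. }
  intros l Hl Hrl.
  (* If [h l > 0], then [l] must be some [s j], since otherwise [r l > 0] forces every [u j l] to
     vanish; the ratio at [j] is 1. If [h l = 0], [Teq] gives [r l * x l = 0]. *)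
  destruct (Rle_lt_or_eq_dec _ _ (Hh0 l Hl)) as [P|P].
  - destruct (classic (exists j, (j < m)%nat /\ l = s j)) as [(j & Hj & ->)|NE].
    + assert (A := Z1 j Hj). unfold z in A.
      apply (Rmult_eq_compat_r (h (s j))) in A.
      rewrite Rmult_assoc, Rinv_l in A; lra.
    + exfalso. rewrite (Hh l Hl) in P.
      rewrite (rsum_ext _ (fun _ => 0)), rsum_const in P; [lra|].
      intros j Hj. destruct (Hs j Hj) as (_ & _ & H3).
      assert (r l * u j l = 0) by (apply H3; auto; intros ->; eauto).
      nra.
  - specialize (Teq l Hl). rewrite <- P in *.
    assert (r l * x l = 0) by (rewrite <- Teq; ring). nra.
Qed.

(** * Sequences of reals *)

Lemma Un_cv_const c : Un_cv (fun _ => c) c.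
Proof.
  intros e He; exists 0%nat; intros; unfold Rdist.
  replace (c - c) with 0 by ring; now rewrite Rabs_R0.
Qed.

Lemma increasing_ge_id (phi : nat -> nat) :
  (forall a b, (a < b)%nat -> (phi a < phi b)%nat) -> forall j, (j <= phi j)%nat.
Proof.
  intros H; induction j as [|j IH]; [lia|].
  assert (phi j < phi (S j))%nat by auto. lia.
Qed.

Lemma Un_cv_subseq (u : nat -> R) l phi :
  (forall a b, (a < b)%nat -> (phi a < phi b)%nat) ->
  Un_cv u l -> Un_cv (fun j => u (phi j)) l.
Proof.
  intros Hp H e He; destruct (H e He) as [M HM]; exists M; intros j Hj.
  apply HM. assert (A := increasing_ge_id phi Hp j). lia.
Qed.

Lemma Un_cv_squeeze0 (u v : nat -> R) :
  (forall j, 0 <= u j <= v j) -> Un_cv v 0 -> Un_cv u 0.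
Proof.
  intros H C e He; destruct (C e He) as [M HM]; exists M; intros j Hj.
  specialize (HM j Hj); specialize (H j). unfold Rdist in *.
  rewrite Rabs_right in * by lra. lra.
Qed.

Lemma Un_cv_rsum (f : nat -> nat -> R) (g : nat -> R) n :
  (forall l, (l < n)%nat -> Un_cv (fun j => f j l) (g l)) ->
  Un_cv (fun j => rsum (f j) n) (rsum g n).
Proof.
  induction n as [|n IH]; simpl; intros H.
  - apply Un_cv_const.
  - apply (CV_plus (fun j => rsum (f j) n) (fun j => f j n)); auto with arith.
Qed.

Lemma bounded_subsequence (u : nat -> R) B :
  (forall j, Rabs (u j) <= B) ->
  exists phi l, (forall a b, (a < b)%nat -> (phi a < phi b)%nat) /\
    Un_cv (fun j => u (phi j)) l.
Proof.
  intros HB.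
  destruct (Bolzano_Weierstrass u (fun c => - B <= c <= B)) as [l Hl].
  { apply compact_P3. }
  { intros j; specialize (HB j); revert HB; unfold Rabs;
      destruct (Rcase_abs (u j)); lra. }
  assert (Hpos : forall q : nat, 0 < / (INR q + 1)).
  { intros q; apply Rinv_0_lt_compat; assert (A := pos_INR q); lra. }
  (* An adherent value is approached arbitrarily late: [fst pq] is the least admissible index and
     [snd pq] sets the precision. Iterating the choice from the successor of the last index gives a
     strictly increasing [phi]. *)
  assert (C : forall pq : nat * nat, exists p', (fst pq <= p')%nat /\
             Rabs (u p' - l) < / (INR (snd pq) + 1)).
  { intros [p q]; simpl.
    apply (Hl (fun v => Rabs (v - l) < / (INR q + 1)) p).
    exists (mkposreal _ (Hpos q)). intros v Hv; exact Hv. }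
  destruct (functional_choice _ C) as [c Hc].
  set (phi := fix phi j := match j with
                | O => c (O, O) | S p => c (S (phi p), S p) end).
  exists phi, l; split.
  - intros a b Hab; induction Hab as [|b Hab IH]; simpl.
    + apply (Hc (S (phi a), S a)).
    + destruct (Hc (S (phi b), S b)) as [A _]; simpl in A; lia.
  - intros e He. destruct (archimed_cor1 e He) as (M & HM & HM0).
    exists M; intros j Hj.
    assert (A : Rabs (u (phi j) - l) < / (INR j + 1)).
    { destruct j; simpl phi; [apply (Hc (O, O)) | apply (Hc (S (phi j), S j))]. }
    unfold Rdist. apply Rlt_trans with (/ (INR j + 1)); auto.
    apply Rlt_trans with (/ INR M); auto.
    apply Rinv_lt_contravar.
    + apply Rmult_lt_0_compat; [apply lt_0_INR; auto|].
      assert (B0 := pos_INR j); lra.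
    + apply le_INR in Hj; lra.
Qed.
(** * Scalars *)

Ltac scalar_ring k :=
  destruct k; cbn in *; [ring | apply injective_projections; cbn; ring].

Lemma Kadd_assoc k (a b c : K k) : Kadd k a (Kadd k b c) = Kadd k (Kadd k a b) c.
Proof. scalar_ring k. Qed.
Lemma Kadd_0_l k (a : K k) : Kadd k (K0 k) a = a.
Proof. scalar_ring k. Qed.
Lemma Kadd_0_r k (a : K k) : Kadd k a (K0 k) = a.
Proof. scalar_ring k. Qed.
Lemma Kmul_comm k (a b : K k) : Kmul k a b = Kmul k b a.
Proof. scalar_ring k. Qed.
Lemma Kmul_assoc k (a b c : K k) : Kmul k a (Kmul k b c) = Kmul k (Kmul k a b) c.
Proof. scalar_ring k. Qed.
Lemma Kmul_0_l k (a : K k) : Kmul k (K0 k) a = K0 k.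
Proof. scalar_ring k. Qed.
Lemma Kmul_0_r k (a : K k) : Kmul k a (K0 k) = K0 k.
Proof. scalar_ring k. Qed.
Lemma Kmul_1_l k (a : K k) : Kmul k (K1 k) a = a.
Proof. scalar_ring k. Qed.
Lemma Kmul_1_r k (a : K k) : Kmul k a (K1 k) = a.
Proof. scalar_ring k. Qed.
Lemma Kmul_add_r k (a b c : K k) :
  Kmul k a (Kadd k b c) = Kadd k (Kmul k a b) (Kmul k a c).
Proof. scalar_ring k. Qed.
Lemma Kmul_add_l k (a b c : K k) :
  Kmul k (Kadd k a b) c = Kadd k (Kmul k a c) (Kmul k b c).
Proof. scalar_ring k. Qed.
Lemma Kof_add k a b : Kof k (a + b) = Kadd k (Kof k a) (Kof k b).
Proof. scalar_ring k. Qed.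
Lemma Kof_mul k a b : Kof k (a * b) = Kmul k (Kof k a) (Kof k b).
Proof. scalar_ring k. Qed.

(** The real inner product, Re(z conj w) in the complex case. It lets both fields share the proofs
    about moduli. *)
Definition Kdot (k : fld) : K k -> K k -> R :=
  match k with FR => Rmult | FC => fun z w => fst z * fst w + snd z * snd w end.

Lemma Kabs_nonneg k (a : K k) : 0 <= Kabs k a.
Proof. destruct k; cbn; [apply Rabs_pos | apply sqrt_pos]. Qed.

Lemma Kabs_sq k (a : K k) : Kabs k a ^ 2 = Kdot k a a.
Proof.
  destruct k; cbn.
  - rewrite Rmult_1_r, <- Rabs_mult, Rabs_right; nra.
  - unfold Cmod. rewrite Rmult_1_r, sqrt_sqrt; nra.
Qed.

Lemma Kabs_of_sq k (a : K k) c : 0 <= c -> Kdot k a a = c ^ 2 -> Kabs k a = c.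
Proof.
  intros Hc H; rewrite <- Kabs_sq in H.
  assert (P := Kabs_nonneg k a). nra.
Qed.

Lemma Kabs_Kof k c : 0 <= c -> Kabs k (Kof k c) = c.
Proof. intros; apply Kabs_of_sq; auto; destruct k; cbn; ring. Qed.

Lemma Kabs_Kof_Rabs k c : Kabs k (Kof k c) = Rabs c.
Proof.
  apply Kabs_of_sq; [apply Rabs_pos|].
  rewrite RPow_abs, Rabs_right by nra. destruct k; cbn; ring.
Qed.

Lemma Kabs_0 k : Kabs k (K0 k) = 0.
Proof. apply Kabs_Kof; lra. Qed.

Lemma Kabs_1 k : Kabs k (K1 k) = 1.
Proof. apply Kabs_Kof; lra. Qed.

Lemma Kabs_eq0 k (a : K k) : Kabs k a = 0 -> a = K0 k.
Proof.
  intros H; assert (E := Kabs_sq k a); rewrite H in E.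
  destruct k; cbn in *; [nra | apply injective_projections; cbn; nra].
Qed.

Lemma Kabs_mul k (a b : K k) : Kabs k (Kmul k a b) = Kabs k a * Kabs k b.
Proof.
  apply Kabs_of_sq; [apply Rmult_le_pos; apply Kabs_nonneg|].
  rewrite Rpow_mult_distr, !Kabs_sq; destruct k; cbn; ring.
Qed.

Lemma Kabs_opp k (a : K k) : Kabs k (Kopp k a) = Kabs k a.
Proof.
  apply Kabs_of_sq; [apply Kabs_nonneg|].
  rewrite Kabs_sq; destruct k; cbn; ring.
Qed.

Lemma Kdot_le k (a b : K k) : Kdot k a b <= Kabs k a * Kabs k b.
Proof.
  assert (Pa := Kabs_nonneg k a). assert (Pb := Kabs_nonneg k b).
  assert (H : Kdot k a b ^ 2 <= (Kabs k a * Kabs k b) ^ 2).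
  { rewrite Rpow_mult_distr, !Kabs_sq; destruct k; cbn; [lra|].
    assert (0 <= (fst a * snd b - snd a * fst b) ^ 2) by apply pow2_ge_0. nra. }
  assert (0 <= Kabs k a * Kabs k b) by nra.
  destruct (Rle_lt_dec (Kdot k a b) (Kabs k a * Kabs k b)); auto. nra.
Qed.

Lemma Kdot_add_l k (a b c : K k) : Kdot k (Kadd k a b) c = Kdot k a c + Kdot k b c.
Proof. destruct k; cbn; ring. Qed.

Lemma Kdot_comm k (a b : K k) : Kdot k a b = Kdot k b a.
Proof. destruct k; cbn; ring. Qed.

Lemma Kdot_Kof_mul k c (a b : K k) :
  Kdot k (Kmul k (Kof k c) a) b = c * Kdot k a b.
Proof. destruct k; cbn; ring. Qed.

Lemma Kabs_add k (a b : K k) : Kabs k (Kadd k a b) <= Kabs k a + Kabs k b.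
Proof.
  assert (Pa := Kabs_nonneg k a). assert (Pb := Kabs_nonneg k b).
  assert (Pc := Kabs_nonneg k (Kadd k a b)).
  assert (D := Kdot_le k a b).
  assert (E : Kabs k (Kadd k a b) ^ 2
              = Kabs k a ^ 2 + Kabs k b ^ 2 + 2 * Kdot k a b).
  { rewrite !Kabs_sq, Kdot_add_l, !(Kdot_comm k _ (Kadd k a b)), !Kdot_add_l,
      (Kdot_comm k b a); ring. }
  nra.
Qed.

(** Quantitative strict convexity of the squared modulus: the last term measures the loss at a
    proper convex combination. *)
Lemma Kabs_convex_sq k t (b c : K k) :
  Kabs k (Kadd k (Kmul k (Kof k t) b) (Kmul k (Kof k (1 - t)) c)) ^ 2
  = t * Kabs k b ^ 2 + (1 - t) * Kabs k c ^ 2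
    - t * (1 - t) * Kabs k (Kadd k b (Kopp k c)) ^ 2.
Proof. rewrite !Kabs_sq; destruct k; cbn; ring. Qed.

Lemma Ksub_eq0 k (a b : K k) : Kabs k (Kadd k a (Kopp k b)) = 0 -> a = b.
Proof.
  intros H; apply Kabs_eq0 in H.
  destruct k; cbn in *; [lra|].
  apply injective_projections;
    [apply (f_equal fst) in H | apply (f_equal snd) in H]; cbn in H; lra.
Qed.

Lemma unimodular_factor k (a b : K k) :
  Kabs k a = Kabs k b -> exists th, Kabs k th = 1 /\ b = Kmul k th a.
Proof.
  intros H.
  destruct (Req_dec (Kabs k a) 0) as [E|E].
  - exists (K1 k); split; [apply Kabs_1|].
    rewrite Kmul_1_l, (Kabs_eq0 k a E). apply Kabs_eq0; congruence.
  - assert (X : exists th, b = Kmul k th a).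
    { assert (S := Kabs_sq k a).
      assert (S2 : Kdot k a a <> 0) by (rewrite <- S; apply pow_nonzero, E).
      clear H E S.
      destruct k; cbn in *.
      (* The factor is the quotient [b / a], written in the complex case as [b] times the conjugate
         of [a] over the squared modulus of [a]. *)
      - exists (b * / a); field. intros ->; lra.
      - exists ((fst b * fst a + snd b * snd a)
                 / (fst a * fst a + snd a * snd a),
                (snd b * fst a - fst b * snd a)
                 / (fst a * fst a + snd a * snd a)).
        apply injective_projections; cbn; field; auto. }
    destruct X as [th X]; exists th; split; auto.
    apply (f_equal (Kabs k)) in X; rewrite Kabs_mul, <- H in X.
    apply (Rmult_eq_reg_r (Kabs k a)); auto; lra.
Qed.

(** * Finite sums and products of scalars *)

Fixpoint Kprodn (k : fld) (f : nat -> K k) (n : nat) : K k :=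
  match n with O => K1 k | S p => Kmul k (Kprodn k f p) (f p) end.

Lemma Ksum_ext k f g n :
  (forall i, (i < n)%nat -> f i = g i) -> Ksum k f n = Ksum k g n.
Proof.
  induction n as [|n IH]; cbn; intros H; auto.
  rewrite IH, (H n); auto with arith.
Qed.

Lemma Ksum_Kof k f n : Ksum k (fun i => Kof k (f i)) n = Kof k (rsum f n).
Proof. induction n as [|n IH]; cbn; auto. rewrite IH; symmetry; apply Kof_add. Qed.

Lemma Kprodn_Kof k f n : Kprodn k (fun i => Kof k (f i)) n = Kof k (rprod f n).
Proof. induction n as [|n IH]; cbn; auto. rewrite IH; symmetry; apply Kof_mul. Qed.

Lemma Kabs_Kprodn k f n : Kabs k (Kprodn k f n) = rprod (fun i => Kabs k (f i)) n.
Proof.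
  induction n as [|n IH]; cbn; [apply Kabs_1|]. rewrite Kabs_mul, IH; auto.
Qed.

Lemma Kabs_Ksum k f n : Kabs k (Ksum k f n) <= rsum (fun i => Kabs k (f i)) n.
Proof.
  induction n as [|n IH]; cbn; [rewrite Kabs_0; lra|].
  eapply Rle_trans; [apply Kabs_add|]. lra.
Qed.

Lemma Kdot_Ksum k f n c :
  Kdot k (Ksum k f n) c = rsum (fun i => Kdot k (f i) c) n.
Proof.
  induction n as [|n IH]; cbn.
  - destruct k; cbn; ring.
  - rewrite Kdot_add_l, IH; auto.
Qed.

Lemma Ksum_single k f n i :
  (i < n)%nat -> (forall l, (l < n)%nat -> l <> i -> f l = K0 k) ->
  Ksum k f n = f i.
Proof.
  induction n as [|n IH]; cbn; intros Hi H; [lia|].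
  destruct (Nat.eq_dec i n) as [->|].
  - rewrite (Ksum_ext k f (fun _ => Kof k 0)).
    + rewrite Ksum_Kof, rsum_const, Rmult_0_r. apply Kadd_0_l.
    + intros l Hl; apply H; lia.
  - rewrite IH, (H n); try lia; [apply Kadd_0_r|]. intros; apply H; lia.
Qed.

(* With [lam] the phase of the sum, each [Re (conj lam * x_l)] is at most [h_l]
   and the weighted sums agree, so [|x_l - lam h_l|^2 <= 0]. *)
Lemma triangle_equality k n (c h : nat -> R) (x : nat -> K k) :
  (forall l, (l < n)%nat -> 0 < c l) ->
  (forall l, (l < n)%nat -> Kabs k (x l) = h l) ->
  0 < rsum (fun l => c l * h l) n ->
  Kabs k (Ksum k (fun l => Kmul k (Kof k (c l)) (x l)) n)
    = rsum (fun l => c l * h l) n ->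
  exists lam, Kabs k lam = 1 /\
    forall l, (l < n)%nat -> x l = Kmul k lam (Kof k (h l)).
Proof.
  intros Hc Hx Hp H.
  set (S := Ksum k _ n) in *. set (t := rsum _ n) in *.
  destruct (unimodular_factor k (Kof k t) S) as (lam & L1 & LS).
  { rewrite Kabs_Kof by lra; auto. }
  exists lam; split; auto.
  assert (LL : Kdot k lam lam = 1) by (rewrite <- Kabs_sq, L1; ring).
  assert (T : rsum (fun l => c l * Kdot k (x l) lam) n = t).
  { transitivity (Kdot k S lam).
    - unfold S; rewrite Kdot_Ksum; apply rsum_ext; intros.
      now rewrite Kdot_Kof_mul.
    - rewrite LS, Kmul_comm, Kdot_Kof_mul, LL; ring. }
  assert (D : forall l, (l < n)%nat -> Kdot k (x l) lam <= h l).
  { intros l Hl; rewrite <- (Hx l Hl), <- (Rmult_1_r (Kabs k (x l))), <- L1.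
    apply Kdot_le. }
  assert (E : forall l, (l < n)%nat -> c l * Kdot k (x l) lam = c l * h l).
  { apply rsum_le_eq.
    - intros l Hl; apply Rmult_le_compat_l; [left; auto | auto].
    - rewrite T; unfold t; lra. }
  intros l Hl. apply Ksub_eq0. apply Kabs_of_sq; [lra|].
  assert (El : Kdot k (x l) lam = h l)
    by (apply (Rmult_eq_reg_l (c l)); auto; specialize (Hc l Hl); lra).
  assert (Q : Kdot k (x l) (x l) = h l ^ 2)
    by (rewrite <- Kabs_sq, Hx; auto).
  transitivity (Kdot k (x l) (x l) - 2 * h l * Kdot k (x l) lam
                + h l ^ 2 * Kdot k lam lam).
  - clear. revert x lam. generalize (h l). clear. intros hl x lam.
    generalize (x l); intros z. destruct k; cbn; ring.
  - rewrite El, Q, LL; ring.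
Qed.

(** * Convergence of scalars and vectors *)

(** Complex limits are taken by real and imaginary parts, so that the limit theorems for real
    sequences apply directly. *)
Definition Kcv (k : fld) : (nat -> K k) -> K k -> Prop :=
  match k with
  | FR => fun u l => Un_cv u l
  | FC => fun u l => Un_cv (fun j => fst (u j)) (fst l) /\
                     Un_cv (fun j => snd (u j)) (snd l)
  end.

Lemma Kcv_const k c : Kcv k (fun _ => c) c.
Proof. destruct k; cbn; [|split]; apply Un_cv_const. Qed.

Lemma Kcv_add k u v a b :
  Kcv k u a -> Kcv k v b -> Kcv k (fun j => Kadd k (u j) (v j)) (Kadd k a b).
Proof.
  destruct k; cbn; [apply CV_plus|]. intros [A B] [A' B'].
  split; [apply (CV_plus _ _ _ _ A A') | apply (CV_plus _ _ _ _ B B')].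
Qed.

Lemma Kcv_mul k u v a b :
  Kcv k u a -> Kcv k v b -> Kcv k (fun j => Kmul k (u j) (v j)) (Kmul k a b).
Proof.
  destruct k; cbn; [apply CV_mult|]. intros [A B] [A' B']. split.
  - apply (CV_minus _ _ _ _ (CV_mult _ _ _ _ A A') (CV_mult _ _ _ _ B B')).
  - apply (CV_plus _ _ _ _ (CV_mult _ _ _ _ A B') (CV_mult _ _ _ _ B A')).
Qed.

Lemma Kcv_Kabs k u a : Kcv k u a -> Un_cv (fun j => Kabs k (u j)) (Kabs k a).
Proof.
  destruct k; cbn; [apply cv_cvabs|]. intros [A B]. unfold Cmod.
  apply (continuity_seq sqrt (fun j => fst (u j) ^ 2 + snd (u j) ^ 2)).
  - apply continuity_pt_sqrt; nra.
  - apply (CV_plus (fun j => fst (u j) ^ 2) (fun j => snd (u j) ^ 2));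
      apply (continuity_seq (fun t => t ^ 2)); auto; reg.
Qed.

Lemma Kcv_dist k u a :
  Kcv k u a -> Un_cv (fun j => Kabs k (Kadd k (u j) (Kopp k a))) 0.
Proof.
  intros H. rewrite <- (Kabs_0 k).
  replace (K0 k) with (Kadd k a (Kopp k a)) by scalar_ring k.
  apply (Kcv_Kabs k (fun j => Kadd k (u j) (Kopp k a))).
  apply Kcv_add; [exact H | apply Kcv_const].
Qed.

Lemma Kcv_subseq k u a phi :
  (forall a b, (a < b)%nat -> (phi a < phi b)%nat) ->
  Kcv k u a -> Kcv k (fun j => u (phi j)) a.
Proof.
  intros Hp; destruct k; cbn; [now apply Un_cv_subseq|].
  intros [A B]; split.
  - now apply (Un_cv_subseq (fun j => fst (u j))).
  - now apply (Un_cv_subseq (fun j => snd (u j))).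
Qed.

Lemma Kcv_Ksum k (f : nat -> nat -> K k) g n :
  (forall l, (l < n)%nat -> Kcv k (fun j => f j l) (g l)) ->
  Kcv k (fun j => Ksum k (f j) n) (Ksum k g n).
Proof.
  induction n as [|n IH]; cbn; intros H; [apply Kcv_const|].
  apply (Kcv_add k (fun j => Ksum k (f j) n) (fun j => f j n));
    auto with arith.
Qed.

Lemma Kbounded_subsequence k (u : nat -> K k) B :
  (forall j, Kabs k (u j) <= B) ->
  exists phi l, (forall a b, (a < b)%nat -> (phi a < phi b)%nat) /\
    Kcv k (fun j => u (phi j)) l.
Proof.
  destruct k; cbn; [apply bounded_subsequence|]. intros H.
  assert (Hsq : forall j, 0 <= B /\ fst (u j) ^ 2 + snd (u j) ^ 2 <= B ^ 2).
  { intros j; specialize (H j); unfold Cmod in H.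
    assert (P := sqrt_pos (fst (u j) ^ 2 + snd (u j) ^ 2)).
    assert (E := sqrt_sqrt (fst (u j) ^ 2 + snd (u j) ^ 2) ltac:(nra)).
    split; nra. }
  (* First extract along the real parts, then along the imaginary parts of that subsequence; the
     first limit survives the second extraction. *)
  destruct (bounded_subsequence (fun j => fst (u j)) B) as (p1 & l1 & P1 & L1).
  { intros j; destruct (Hsq j); apply Rabs_le; nra. }
  destruct (bounded_subsequence (fun j => snd (u (p1 j))) B)
    as (p2 & l2 & P2 & L2).
  { intros j; destruct (Hsq (p1 j)); apply Rabs_le; nra. }
  exists (fun j => p1 (p2 j)), (l1, l2); repeat split; auto.
  cbn; apply (Un_cv_subseq (fun j => fst (u (p1 j)))); auto.
Qed.

Lemma vec_bounded_subsequence k n (xs : nat -> vec k) B :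
  (forall j, inX k n (xs j)) -> (forall j l, Kabs k (xs j l) <= B) ->
  exists phi x, (forall a b, (a < b)%nat -> (phi a < phi b)%nat) /\
    inX k n x /\ forall l, Kcv k (fun j => xs (phi j) l) (x l).
Proof.
  intros HX HB.
  (* Coordinates are handled one at a time, refining the subsequence for each new one. Those from
     [n] on are constantly 0. *)
  assert (A : forall p, exists phi x,
    (forall a b, (a < b)%nat -> (phi a < phi b)%nat) /\
    forall l, (l < p)%nat -> Kcv k (fun j => xs (phi j) l) (x l)).
  { induction p as [|p (phi & x & Hphi & Hx)].
    - exists (fun j => j), (fun _ => K0 k); split; intros; lia.
    - destruct (Kbounded_subsequence k (fun j => xs (phi j) p) B)
        as (psi & y & Hpsi & Hy); auto.
      exists (fun j => phi (psi j)), (fun l => if Nat.eqb l p then y else x l).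
      split; auto. intros l Hl.
      destruct (Nat.eqb_spec l p) as [->|]; auto.
      apply (Kcv_subseq k (fun j => xs (phi j) l)); auto. apply Hx; lia. }
  destruct (A n) as (phi & x & Hphi & Hx).
  exists phi, (fun l => if Nat.ltb l n then x l else K0 k); repeat split; auto.
  - intros i Hi; destruct (Nat.ltb_spec i n); auto; lia.
  - intros l; destruct (Nat.ltb_spec l n); auto.
    replace (fun j => xs (phi j) l) with (fun _ : nat => K0 k).
    + apply Kcv_const.
    + extensionality j; symmetry; apply HX; auto.
Qed.

(** * Homogeneous polynomials *)

Lemma is_mhomog_ext k n m P Q :
  (forall x, Q x = P x) -> is_mhomog k n m P -> is_mhomog k n m Q.
Proof.
  intros H (L & H1 & H2); exists L; split; auto.
  intros x Hx; rewrite H; auto.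
Qed.

Lemma is_mhomog_0 k n m : is_mhomog k n m (fun _ => K0 k).
Proof. exists nil; split; [intros p [] | reflexivity]. Qed.

Lemma is_mhomog_1 k n : is_mhomog k n 0 (fun _ => K1 k).
Proof.
  exists ((K1 k, nil) :: nil); split.
  - intros p [<-|[]]; split; auto. intros i [].
  - intros x _; cbn. rewrite Kadd_0_r, Kmul_1_l; reflexivity.
Qed.

Lemma is_mhomog_add k n m P Q :
  is_mhomog k n m P -> is_mhomog k n m Q ->
  is_mhomog k n m (fun x => Kadd k (P x) (Q x)).
Proof.
  intros (L & H1 & H2) (L' & H1' & H2'); exists (L ++ L'); split.
  - intros p Hp; apply in_app_or in Hp; destruct Hp; auto.
  - intros x Hx; rewrite H2, H2' by auto. clear.
    induction L as [|p L IH]; cbn; [apply Kadd_0_l|].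
    rewrite <- Kadd_assoc; f_equal; exact IH.
Qed.

Lemma is_mhomog_mul_coord k n m P c l :
  (l < n)%nat -> is_mhomog k n m P ->
  is_mhomog k n (S m) (fun x => Kmul k (P x) (Kmul k c (x l))).
Proof.
  intros Hl (L & H1 & H2).
  (* In each monomial the scalar [c] is absorbed into the coefficient and the index [l] is
     prepended. *)
  exists (map (fun p => (Kmul k c (fst p), l :: snd p)) L); split.
  - intros p Hp; apply in_map_iff in Hp; destruct Hp as (q & <- & Hq).
    destruct (H1 q Hq) as [A B]; split; cbn; auto.
    intros i [<-|Hi]; auto.
  - intros x Hx; rewrite H2 by auto. clear.
    induction L as [|p L IH]; [apply Kmul_0_l|].
    cbn [poly_eval fold_right map fst snd Kprod] in *.
    fold (Kprod k (map x (snd p))). fold (poly_eval k L x) in *.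
    rewrite Kmul_add_l, IH; unfold poly_eval. f_equal.
    generalize (Kprod k (map x (snd p))) (x l) (fst p); intros; scalar_ring k.
Qed.

Lemma is_mhomog_Ksum k n m (P : nat -> vec k -> K k) p :
  (forall i, (i < p)%nat -> is_mhomog k n m (P i)) ->
  is_mhomog k n m (fun x => Ksum k (fun i => P i x) p).
Proof.
  induction p as [|p IH]; cbn; intros H; [apply is_mhomog_0|].
  apply is_mhomog_add; auto with arith.
Qed.

Lemma is_mhomog_mul_linear k n m P a :
  is_mhomog k n m P ->
  is_mhomog k n (S m) (fun x => Kmul k (P x) (pair k n a x)).
Proof.
  intros H.
  apply is_mhomog_ext with
    (fun x => Ksum k (fun l => Kmul k (P x) (Kmul k (a l) (x l))) n).
  - intros x; unfold pair. generalize n as p.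
    induction p as [|p IH]; cbn; [apply Kmul_0_r|].
    now rewrite Kmul_add_r, IH.
  - apply (is_mhomog_Ksum k n (S m)
      (fun l x => Kmul k (P x) (Kmul k (a l) (x l)))).
    intros; now apply is_mhomog_mul_coord.
Qed.

Lemma is_mhomog_monomial k n m (s : nat -> nat) :
  (forall j, (j < m)%nat -> (s j < n)%nat) ->
  is_mhomog k n m (fun x => Kprodn k (fun j => x (s j)) m).
Proof.
  induction m as [|m IH]; cbn; intros H; [apply is_mhomog_1|].
  apply is_mhomog_ext with (fun x =>
    Kmul k (Kprodn k (fun j => x (s j)) m) (Kmul k (K1 k) (x (s m)))).
  - intros x; now rewrite Kmul_1_l.
  - apply is_mhomog_mul_coord; auto with arith.
Qed.

Lemma is_mhomog_linear_pow k n m a :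
  is_mhomog k n m (fun x => Kprodn k (fun _ => pair k n a x) m).
Proof.
  induction m as [|m IH]; cbn; [apply is_mhomog_1|].
  now apply is_mhomog_mul_linear.
Qed.

(** Polynomials are continuous for coordinatewise convergence: sums and products pass to the limit
    along the representing list. *)
Lemma is_mhomog_cv k n m Q xs x :
  is_mhomog k n m Q -> (forall j, inX k n (xs j)) -> inX k n x ->
  (forall l, Kcv k (fun j => xs j l) (x l)) ->
  Kcv k (fun j => Q (xs j)) (Q x).
Proof.
  intros (L & _ & HQ) Hxs Hx C.
  rewrite (HQ x Hx).
  replace (fun j => Q (xs j)) with (fun j => poly_eval k L (xs j))
    by (extensionality j; symmetry; auto).
  clear - C; induction L as [|[c p] L IH]; [exact (Kcv_const k (K0 k))|].
  cbn. apply (Kcv_add k (fun j => Kmul k c (Kprod k (map (xs j) p)))); auto.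
  apply Kcv_mul; [apply Kcv_const|].
  clear - C; induction p as [|l p IH]; [exact (Kcv_const k (K1 k))|].
  cbn. apply (Kcv_mul k (fun j => xs j l)); auto.
Qed.

(** * Absolute norms *)

Lemma absolute_norm_modulus k n N x y :
  absolute_norm k n N -> inX k n x -> inX k n y ->
  (forall l, Kabs k (x l) = Kabs k (y l)) -> N x = N y.
Proof.
  intros (_ & HA & _) Hx Hy H; rewrite (HA x Hx), (HA y Hy).
  f_equal; extensionality l; unfold vabs; now rewrite H.
Qed.

Lemma inX_modulus k n x y :
  inX k n x -> (forall l, Kabs k (y l) = Kabs k (x l)) -> inX k n y.
Proof.
  intros Hx H l Hl; apply Kabs_eq0; rewrite H, (Hx l Hl); apply Kabs_0.
Qed.

Lemma in_ball_modulus k n N x y :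
  absolute_norm k n N -> in_ball k n N x ->
  (forall l, Kabs k (y l) = Kabs k (x l)) -> in_ball k n N y.
Proof.
  intros HN [Hx Bx] H. assert (Hy := inX_modulus k n x y Hx H).
  split; auto. now rewrite (absolute_norm_modulus k n N y x).
Qed.

Lemma inX_evec k n i : (i < n)%nat -> inX k n (evec k i).
Proof.
  intros Hi l Hl; unfold evec; destruct (Nat.eqb_spec l i); auto; lia.
Qed.

Lemma inX_vadd k n x y : inX k n x -> inX k n y -> inX k n (vadd k x y).
Proof. intros Hx Hy l Hl; unfold vadd; rewrite Hx, Hy; auto; apply Kadd_0_l. Qed.

Lemma inX_vscal k n a x : inX k n x -> inX k n (vscal k a x).
Proof. intros Hx l Hl; unfold vscal; rewrite Hx; auto; apply Kmul_0_r. Qed.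

Lemma inX_vsub k n x y : inX k n x -> inX k n y -> inX k n (vsub k x y).
Proof. intros Hx Hy l Hl; unfold vsub; rewrite Hx, Hy; auto; scalar_ring k. Qed.

(** Changing the sign of every coordinate but the [l]-th preserves an absolute norm, and adding the
    result to [x] leaves [2 * x l] times a unit basis vector. *)
Lemma coord_le_norm k n N x l :
  absolute_norm k n N -> inX k n x -> (l < n)%nat -> Kabs k (x l) <= N x.
Proof.
  intros HN Hx Hl. assert (HN' := HN).
  destruct HN' as ((_ & _ & Hhom & Htri) & _ & He).
  set (y := fun i => if Nat.eqb i l then x i else Kopp k (x i)).
  assert (My : forall i, Kabs k (y i) = Kabs k (x i)).
  { intros i; unfold y; destruct (Nat.eqb i l); auto; apply Kabs_opp. }
  assert (Hy := inX_modulus k n x y Hx My).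
  assert (Ny := absolute_norm_modulus k n N y x HN Hy Hx My).
  assert (T := Htri x y Hx Hy).
  replace (vadd k x y) with (vscal k (Kmul k (Kof k 2) (x l)) (evec k l)) in T.
  - rewrite Hhom, He, Kabs_mul, Kabs_Kof, Ny in T by (auto using inX_evec; lra).
    lra.
  - extensionality i; unfold vadd, vscal, evec, y.
    destruct (Nat.eqb_spec i l) as [->|].
    + generalize (x l); intros; scalar_ring k.
    + generalize (x l) (x i); intros; scalar_ring k.
Qed.

Lemma norm_le_sum k n N x :
  absolute_norm k n N -> inX k n x -> N x <= rsum (fun l => Kabs k (x l)) n.
Proof.
  intros ((_ & _ & Hhom & Htri) & _ & He) Hx.
  (* Truncations to the first [p] coordinates; passing to [S p] adds a multiple of a basis vector of
     norm 1. *)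
  set (tr := fun p l => if Nat.ltb l p then x l else K0 k).
  assert (Htr : forall p, inX k n (tr p)).
  { intros p l Hl; unfold tr; rewrite Hx by auto. now destruct (Nat.ltb l p). }
  assert (A : forall p, (p <= n)%nat -> N (tr p) <= rsum (fun l => Kabs k (x l)) p).
  { induction p as [|p IH]; intros Hp.
    - replace (tr O) with (vscal k (K0 k) x).
      + rewrite Hhom, Kabs_0 by auto; simpl; lra.
      + extensionality l; unfold vscal, tr; simpl; apply Kmul_0_l.
    - replace (tr (S p)) with (vadd k (tr p) (vscal k (x p) (evec k p))).
      + eapply Rle_trans.
        * apply Htri; auto. apply inX_vscal, inX_evec; lia.
        * rewrite Hhom, He by (try apply inX_evec; lia). simpl.
          assert (N (tr p) <= rsum (fun l => Kabs k (x l)) p) by (apply IH; lia).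
          lra.
      + extensionality l; unfold vadd, vscal, evec, tr.
        destruct (Nat.eqb_spec l p) as [->|].
        * destruct (Nat.ltb_spec p p); [lia|].
          destruct (Nat.ltb_spec p (S p)); [|lia].
          rewrite Kmul_1_r; apply Kadd_0_l.
        * rewrite Kmul_0_r, Kadd_0_r.
          destruct (Nat.ltb_spec l p), (Nat.ltb_spec l (S p)); auto; lia. }
  replace x with (tr n) at 1; auto.
  extensionality l; unfold tr; destruct (Nat.ltb_spec l n); auto.
  symmetry; now apply Hx.
Qed.

Lemma norm_cv k n N xs x :
  absolute_norm k n N -> (forall j, inX k n (xs j)) -> inX k n x ->
  (forall l, Kcv k (fun j => xs j l) (x l)) ->
  Un_cv (fun j => N (vsub k (xs j) x)) 0.
Proof.
  intros HN Hxs Hx C.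
  apply Un_cv_squeeze0 with
    (fun j => rsum (fun l => Kabs k (Kadd k (xs j l) (Kopp k (x l)))) n).
  - intros j. assert (H := inX_vsub k n _ _ (Hxs j) Hx). split.
    + now apply HN.
    + now apply (norm_le_sum k n N (vsub k (xs j) x)).
  - replace 0 with (rsum (fun _ => 0) n) by (rewrite rsum_const; ring).
    apply (Un_cv_rsum
      (fun j l => Kabs k (Kadd k (xs j l) (Kopp k (x l)))) (fun _ => 0)).
    intros l _; apply (Kcv_dist k (fun j => xs j l)); auto.
Qed.

Lemma ball_closed k n N xs x :
  absolute_norm k n N -> (forall j, in_ball k n N (xs j)) -> inX k n x ->
  (forall l, Kcv k (fun j => xs j l) (x l)) -> in_ball k n N x.
Proof.
  intros HN Hxs Hx C. split; auto.
  assert (Hxs' : forall j, inX k n (xs j)) by (intros j; apply Hxs).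
  assert (D := norm_cv k n N xs x HN Hxs' Hx C).
  (* The triangle inequality for [x = xs j - (xs j - x)] bounds [N x] by a sequence tending to 1. *)
  apply (Rle_cv_lim (Un := fun _ => N x)
    (Vn := fun j => 1 + N (vsub k (xs j) x))).
  - intros j. assert (H := inX_vsub k n _ _ (Hxs' j) Hx).
    assert (HN' := HN). destruct HN' as ((_ & _ & Hhom & Htri) & _).
    assert (T := Htri (xs j) (vscal k (Kof k (-1)) (vsub k (xs j) x))
                   (Hxs' j) (inX_vscal k n _ _ H)).
    rewrite Hhom, Kabs_Kof_Rabs, Rabs_left in T by (auto; lra).
    replace (vadd k (xs j) (vscal k (Kof k (-1)) (vsub k (xs j) x))) with x in T.
    + destruct (Hxs j) as [_ B]. lra.
    + extensionality l; unfold vadd, vscal, vsub.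
      generalize (xs j l) (x l); intros; scalar_ring k.
  - apply Un_cv_const.
  - replace 1 with (1 + 0) at 1 by ring.
    apply (CV_plus (fun _ => 1)); auto. apply Un_cv_const.
Qed.

(** * The dual ball *)

Lemma pair_Kof k n r u :
  pair k n (fun l => Kof k (r l)) (fun l => Kof k (u l))
  = Kof k (rsum (fun l => r l * u l) n).
Proof.
  unfold pair; rewrite <- Ksum_Kof; apply Ksum_ext; intros; now rewrite Kof_mul.
Qed.

Lemma pair_evec_r k n a i : (i < n)%nat -> pair k n a (evec k i) = a i.
Proof.
  intros Hi; unfold pair; rewrite (Ksum_single _ _ n i Hi).
  - unfold evec; rewrite Nat.eqb_refl; apply Kmul_1_r.
  - intros l _ Hl; unfold evec; destruct (Nat.eqb_spec l i); [lia|].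
    apply Kmul_0_r.
Qed.

Lemma pair_evec_l k n x i : (i < n)%nat -> pair k n (evec k i) x = x i.
Proof.
  intros Hi; unfold pair; rewrite (Ksum_single _ _ n i Hi).
  - unfold evec; rewrite Nat.eqb_refl; apply Kmul_1_l.
  - intros l _ Hl; unfold evec; destruct (Nat.eqb_spec l i); [lia|].
    apply Kmul_0_l.
Qed.

(** The phases relating [b] to [a] can be moved onto the argument, where an absolute norm does not
    see them. *)
Lemma in_dual_ball_modulus k n N a b :
  absolute_norm k n N -> in_dual_ball k n N a ->
  (forall l, Kabs k (b l) = Kabs k (a l)) -> in_dual_ball k n N b.
Proof.
  intros HN [Ha Da] H; split; [now apply inX_modulus with a|].
  destruct (functional_choice (fun l th => Kabs k th = 1 /\ b l = Kmul k th (a l)))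
    as [th Hth].
  { intros l; apply unimodular_factor; auto. }
  intros x Hx.
  replace (pair k n b x) with (pair k n a (fun l => Kmul k (th l) (x l))).
  - apply Da, (in_ball_modulus k n N x); auto.
    intros l; rewrite Kabs_mul; destruct (Hth l) as [-> _]; ring.
  - apply Ksum_ext; intros l _; destruct (Hth l) as [_ ->].
    now rewrite Kmul_assoc, (Kmul_comm k (a l)).
Qed.

Lemma in_dual_ball_coord k n N a l :
  absolute_norm k n N -> in_dual_ball k n N a -> Kabs k (a l) <= 1.
Proof.
  intros HN [Ha Da]; destruct (Nat.lt_ge_cases l n) as [Hl|Hl].
  - rewrite <- (pair_evec_r k n a l Hl); apply Da; split.
    + now apply inX_evec.
    + right; now apply HN.
  - rewrite (Ha l Hl), Kabs_0; lra.
Qed.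

Lemma in_dual_ball_evec k n N i :
  absolute_norm k n N -> (i < n)%nat -> in_dual_ball k n N (evec k i).
Proof.
  intros HN Hi; split; [now apply inX_evec|].
  intros x [Hx Bx]; rewrite pair_evec_l by auto.
  apply Rle_trans with (N x); auto. now apply coord_le_norm with n.
Qed.

Lemma dual_ball_closed k n N (xs : nat -> vec k) a :
  (forall j, in_dual_ball k n N (xs j)) -> inX k n a ->
  (forall l, Kcv k (fun j => xs j l) (a l)) -> in_dual_ball k n N a.
Proof.
  intros Hxs Ha C; split; auto. intros x Hx.
  apply (Rle_cv_lim (Un := fun j => Kabs k (pair k n (xs j) x))
    (Vn := fun _ => 1)).
  - intros j; now apply Hxs.
  - apply Kcv_Kabs.
    apply (Kcv_Ksum k (fun j l => Kmul k (xs j l) (x l))); intros l _.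
    apply Kcv_mul; auto using Kcv_const.
  - apply Un_cv_const.
Qed.

(* [|a_i| = 1] cuts out a union of faces, and the strictly convex function
   [sum_l |a_l|^2] has its maxima over it at extreme points. *)
Lemma extreme_of_max k n N i a :
  absolute_norm k n N -> (i < n)%nat ->
  in_dual_ball k n N a -> Kabs k (a i) = 1 ->
  (forall b, in_dual_ball k n N b -> Kabs k (b i) = 1 ->
     rsum (fun l => Kabs k (b l) ^ 2) n <= rsum (fun l => Kabs k (a l) ^ 2) n) ->
  extreme_dual_ball k n N a.
Proof.
  intros HN Hi Da Ai Max; split; auto. intros b c t Db Dc Ht E.
  assert (Bi := in_dual_ball_coord k n N b i HN Db).
  assert (Ci := in_dual_ball_coord k n N c i HN Dc).
  assert (Pb := Kabs_nonneg k (b i)). assert (Pc := Kabs_nonneg k (c i)).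
  assert (Sq : forall l, Kabs k (a l) ^ 2
      = t * Kabs k (b l) ^ 2 + (1 - t) * Kabs k (c l) ^ 2
        - t * (1 - t) * Kabs k (Kadd k (b l) (Kopp k (c l))) ^ 2).
  { intros l; rewrite E; apply Kabs_convex_sq. }
  (* The modulus 1 of [a i] is at most a proper convex combination of two numbers not exceeding 1.
     Thus [b] and [c] are competitors in the maximisation too. *)
  assert (F : Kabs k (b i) = 1 /\ Kabs k (c i) = 1).
  { assert (T : 1 <= t * Kabs k (b i) + (1 - t) * Kabs k (c i)).
    { apply Rle_trans with (Kabs k (a i)); [lra|].
      rewrite E; unfold vconv, vadd, vscal.
      eapply Rle_trans; [apply Kabs_add|].
      rewrite !Kabs_mul, !Kabs_Kof by lra; lra. }
    split; nra. }
  destruct F as [Fb Fc].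
  assert (Mb := Max b Db Fb). assert (Mc := Max c Dc Fc).
  set (d := fun l => Kabs k (Kadd k (b l) (Kopp k (c l))) ^ 2).
  assert (S : rsum (fun l => Kabs k (a l) ^ 2) n
    = t * rsum (fun l => Kabs k (b l) ^ 2) n
      + (1 - t) * rsum (fun l => Kabs k (c l) ^ 2) n + - (t * (1 - t)) * rsum d n).
  { rewrite <- !rsum_scal, <- !rsum_plus; apply rsum_ext; intros l _.
    rewrite Sq; unfold d; ring. }
  assert (Hd : forall l, (l < n)%nat -> 0 <= d l) by (intros; apply pow2_ge_0).
  (* Neither competitor exceeds the maximum, so the convexity loss [t * (1 - t) * rsum d n] cannot
     be positive. *)
  assert (D0 : rsum d n <= 0).
  { set (A := rsum (fun l => Kabs k (a l) ^ 2) n) in *.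
    set (B := rsum (fun l => Kabs k (b l) ^ 2) n) in *.
    set (C := rsum (fun l => Kabs k (c l) ^ 2) n) in *.
    assert (0 < t * (1 - t)) by nra.
    assert (0 <= t * (A - B)) by (apply Rmult_le_pos; lra).
    assert (0 <= (1 - t) * (A - C)) by (apply Rmult_le_pos; lra).
    assert (t * (1 - t) * rsum d n <= 0) by lra.
    nra. }
  extensionality l. destruct (Nat.lt_ge_cases l n) as [Hl|Hl].
  - apply Ksub_eq0. assert (A := rsum_term_le d n l Hd Hl).
    assert (B := Hd l Hl). assert (E0 : d l = 0) by lra. unfold d in E0. nra.
  - destruct Db as [Xb _], Dc as [Xc _]. now rewrite Xb, Xc.
Qed.

(** Compactness: a maximising sequence has a coordinatewise convergent subsequence, and the
    constraints and the objective pass to its limit. The feasible set contains [evec k i]. *)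
Lemma exists_max k n N i :
  absolute_norm k n N -> (i < n)%nat ->
  exists a, in_dual_ball k n N a /\ Kabs k (a i) = 1 /\
    forall b, in_dual_ball k n N b -> Kabs k (b i) = 1 ->
      rsum (fun l => Kabs k (b l) ^ 2) n <= rsum (fun l => Kabs k (a l) ^ 2) n.
Proof.
  intros HN Hi.
  set (f := fun a : vec k => rsum (fun l => Kabs k (a l) ^ 2) n).
  set (F := fun a => in_dual_ball k n N a /\ Kabs k (a i) = 1).
  assert (HF : F (evec k i)).
  { split; [now apply in_dual_ball_evec|].
    unfold evec; rewrite Nat.eqb_refl; apply Kabs_1. }
  destruct (completeness (fun v => exists a, F a /\ v = f a)) as [M [UB LUB]].
  { exists (INR n * 1); intros v (a & [Da _] & ->).
    unfold f; rewrite <- rsum_const; apply rsum_le; intros l _.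
    assert (A := in_dual_ball_coord k n N a l HN Da).
    assert (B := Kabs_nonneg k (a l)). nra. }
  { exists (f (evec k i)), (evec k i); auto. }
  (* Otherwise [M - / (INR j + 1)] would be an upper bound below the least one. *)
  assert (C : forall j : nat, exists a, F a /\ M - / (INR j + 1) < f a).
  { intros j.
    assert (P : 0 < / (INR j + 1))
      by (apply Rinv_0_lt_compat; assert (A := pos_INR j); lra).
    apply NNPP; intros NE.
    assert (M <= M - / (INR j + 1)); [|lra].
    apply LUB; intros v (a & Fa & ->).
    apply Rnot_lt_le; intros L; apply NE; eauto. }
  destruct (functional_choice _ C) as [xs Hxs].
  destruct (vec_bounded_subsequence k n xs 1) as (phi & a & Hphi & Xa & Ca).
  { intros j; apply (Hxs j). }
  { intros j l; apply (in_dual_ball_coord k n N); auto; apply (Hxs j). }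
  exists a; split; [|split].
  - apply dual_ball_closed with (fun j => xs (phi j)); auto.
    intros j; apply (Hxs (phi j)).
  - apply (UL_sequence (fun j => Kabs k (xs (phi j) i))).
    + apply Kcv_Kabs, Ca.
    + replace (fun j => Kabs k (xs (phi j) i)) with (fun _ : nat => 1).
      * apply Un_cv_const.
      * extensionality j; symmetry; apply (Hxs (phi j)).
  - intros b Db Bb. apply Rle_trans with M.
    + apply UB; exists b; repeat split; auto; apply Db.
    + apply (Rle_cv_lim (Un := fun j => M - / (INR j + 1))
        (Vn := fun j => f (xs (phi j)))).
      * intros j; destruct (Hxs (phi j)) as [_ A].
        assert (B := increasing_ge_id phi Hphi j). apply le_INR in B.
        assert (P := pos_INR j).
        assert (/ (INR (phi j) + 1) <= / (INR j + 1))
          by (apply Rinv_le_contravar; lra).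
        lra.
      * replace M with (M - 0) at 1 by ring.
        apply (CV_minus (fun _ => M)); [apply Un_cv_const|].
        intros e He; destruct (archimed_cor1 e He) as (q & Hq & Hq0).
        exists q; intros j Hj; unfold Rdist.
        apply le_INR in Hj. assert (0 < INR q) by (apply lt_0_INR; lia).
        assert (0 < / (INR j + 1)) by (apply Rinv_0_lt_compat; lra).
        rewrite Rminus_0_r, Rabs_right by lra.
        apply Rle_lt_trans with (/ INR q); auto.
        apply Rinv_le_contravar; lra.
      * apply (Un_cv_rsum (fun j l => Kabs k (xs (phi j) l) ^ 2)); intros l _.
        apply (continuity_seq (fun v => v ^ 2)); [reg|].
        apply Kcv_Kabs, Ca.
Qed.

(** Constraint, objective and dual ball depend only on moduli, so every vector with the moduli of a
    maximiser is a maximiser as well. Hence phases may be changed freely without losing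
    extremality. *)
Lemma exists_extreme_moduli k n N i :
  absolute_norm k n N -> (i < n)%nat ->
  exists r : nat -> R, r i = 1 /\ (forall l, 0 <= r l <= 1) /\
    forall a, (forall l, Kabs k (a l) = r l) -> extreme_dual_ball k n N a.
Proof.
  intros HN Hi; destruct (exists_max k n N i HN Hi) as (a & Da & Ai & Max).
  exists (fun l => Kabs k (a l)); split; [|split]; auto.
  - intros l; split; [apply Kabs_nonneg|].
    now apply (in_dual_ball_coord k n N).
  - intros b Hb. apply (extreme_of_max k n N i); auto.
    + now apply (in_dual_ball_modulus k n N a).
    + now rewrite Hb.
    + intros c Dc Ci.
      rewrite (rsum_ext (fun l => Kabs k (b l) ^ 2) (fun l => Kabs k (a l) ^ 2))
        by (intros; now rewrite Hb).
      auto.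
Qed.

(** * The CL property *)

(* Flipping the sign of one coordinate of the functional gives another extreme
   functional, so [|1 - 2 r_l u_l| = 1] for every [l]. *)
Lemma CL_meets_once k n N (r u : nat -> R) :
  CL_space k n N ->
  (forall l, 0 <= r l) -> (forall l, 0 <= u l) ->
  (forall a, (forall l, Kabs k (a l) = r l) -> extreme_dual_ball k n N a) ->
  extreme_ball k n N (fun l => Kof k (u l)) ->
  exists s, (s < n)%nat /\ r s * u s = 1 /\
    forall l, (l < n)%nat -> l <> s -> r l * u l = 0.
Proof.
  intros HCL Hr Hu Ha Hx.
  (* Real functionals suffice here: any choice of signs on [r] is again extreme, over either
     field. *)
  assert (E : forall v : nat -> R, (forall l, Rabs (v l) = r l) ->
              Rabs (rsum (fun l => v l * u l) n) = 1).
  { intros v Hv. rewrite <- (Kabs_Kof_Rabs k), <- pair_Kof.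
    apply HCL; auto. apply Ha. intros l; now rewrite Kabs_Kof_Rabs. }
  assert (S1 : rsum (fun l => r l * u l) n = 1).
  { rewrite <- (E r).
    - symmetry; apply Rabs_right, Rle_ge, rsum_nonneg.
      intros; now apply Rmult_le_pos.
    - intros l; apply Rabs_right, Rle_ge, Hr. }
  apply (zero_one_sum (fun l => r l * u l)); auto.
  intros i Hi.
  assert (F := E (fun l => if Nat.eqb l i then - r l else r l)).
  rewrite (rsum_update (fun l => r l * u l) _ n i Hi) in F.
  - rewrite Nat.eqb_refl, S1 in F.
    assert (G : Rabs (1 + (- r i * u i - r i * u i)) = 1).
    { apply F; intros l; destruct (Nat.eqb l i); rewrite ?Rabs_Ropp;
        apply Rabs_right, Rle_ge, Hr. }
    unfold Rabs in G; destruct (Rcase_abs _) in G; lra.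
  - intros l Hl; destruct (Nat.eqb_spec l i); [lia | auto].
Qed.

(** * Averages in the ball and the polynomial peaking at the average *)

Lemma vavg_in_ball k n N m y :
  absolute_norm k n N -> (1 <= m)%nat ->
  (forall j, (j < m)%nat -> in_ball k n N (y j)) -> in_ball k n N (vavg k m y).
Proof.
  intros HN Hm Hy.
  assert (HN' := HN). destruct HN' as ((_ & _ & Hhom & Htri) & _).
  assert (P : 0 < INR m) by (apply lt_0_INR; lia).
  set (S := fun p i => Ksum k (fun j => y j i) p).
  assert (A : forall p, (p <= m)%nat -> inX k n (S p) /\ N (S p) <= INR p).
  { induction p as [|p IH]; intros Hp.
    - assert (X : inX k n (S O)) by (intros l _; reflexivity).
      split; auto. replace (S O) with (vscal k (K0 k) (S O)).
      + rewrite Hhom, Kabs_0 by auto; simpl; lra.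
      + extensionality l; apply Kmul_0_l.
    - destruct IH as [X B]; [lia|]. destruct (Hy p) as [Xy By]; [lia|].
      split; [exact (inX_vadd k n (S p) (y p) X Xy)|].
      rewrite S_INR. eapply Rle_trans; [exact (Htri (S p) (y p) X Xy)|]. lra. }
  destruct (A m) as [X B]; auto.
  change (vavg k m y) with (vscal k (Kof k (/ INR m)) (S m)).
  assert (0 < / INR m) by now apply Rinv_0_lt_compat.
  split; [now apply inX_vscal|].
  rewrite Hhom, Kabs_Kof by (auto; lra).
  rewrite <- (Rinv_l (INR m)) by lra. apply Rmult_le_compat_l; lra.
Qed.

Lemma pow_strict_incr a b m :
  (1 <= m)%nat -> 0 <= a < b -> a ^ m < b ^ m.
Proof.
  intros Hm [Ha Hab]; destruct m as [|m]; [lia|]; clear Hm; simpl.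
  assert (a ^ m <= b ^ m) by (apply pow_incr; lra).
  assert (0 < b ^ m) by (apply pow_lt; lra).
  nra.
Qed.

Theorem theorem4p5 (k : fld) (n : nat) (N : vec k -> R) (m : nat)
  (y : nat -> vec k) :
  (1 <= n)%nat ->
  absolute_norm k n N ->
  CL_space k n N ->
  (1 <= m)%nat ->
  (forall j, (j < m)%nat -> extreme_ball k n N (y j)) ->
  (forall j, (j < m)%nat -> nonneg_real_coords k n (y j)) ->
  in_rho_tilde k n m N (vavg k m y).
Proof.
  intros Hn HN HCL Hm Hext Hnn.
  assert (Pn : 0 < INR n) by (apply lt_0_INR; lia).
  assert (Pm : 0 < INR m) by (apply lt_0_INR; lia).
  set (u := fun j l => Kabs k (y j l)).
  assert (Yu : forall j, (j < m)%nat -> y j = fun l => Kof k (u j l)).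
  { intros j Hj; extensionality l; unfold u.
    destruct (Nat.lt_ge_cases l n) as [Hl|Hl].
    - destruct (Hnn j Hj l Hl) as (v & Hv & ->). now rewrite Kabs_Kof.
    - destruct (Hext j Hj) as [[X _] _]. rewrite (X l Hl). now rewrite Kabs_0. }
  assert (Hu0 : forall j l, 0 <= u j l) by (intros; apply Kabs_nonneg).
  assert (Hu1 : forall j l, (j < m)%nat -> (l < n)%nat -> 0 <= u j l <= 1).
  { intros j l Hj Hl; split; auto. destruct (Hext j Hj) as [[X B] _].
    apply Rle_trans with (N (y j)); auto. now apply coord_le_norm with n. }
  (* The coordinates of the average, as real numbers. *)
  set (h := fun l => / INR m * rsum (fun j => u j l) m).
  assert (Yh : vavg k m y = fun l => Kof k (h l)).
  { extensionality l; unfold vavg, h. rewrite Kof_mul, <- Ksum_Kof. f_equal.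
    apply Ksum_ext; intros j Hj; exact (f_equal (fun f => f l) (Yu j Hj)). }
  assert (Hh0 : forall l, 0 <= h l).
  { intros l; apply Rmult_le_pos.
    - left; now apply Rinv_0_lt_compat.
    - now apply rsum_nonneg. }
  destruct (functional_choice (fun i r => (i < n)%nat -> r i = 1 /\
    (forall l, 0 <= r l <= 1) /\
    forall a, (forall l, Kabs k (a l) = r l) -> extreme_dual_ball k n N a))
    as [r Hr].
  { intros i; destruct (Nat.lt_ge_cases i n) as [Hi|Hi].
    - destruct (exists_extreme_moduli k n N i HN Hi) as [r Hr]; now exists r.
    - exists (fun _ => 0); lia. }
  destruct (functional_choice (fun (ij : nat * nat) s =>
    (fst ij < n)%nat -> (snd ij < m)%nat ->
    (s < n)%nat /\ r (fst ij) s * u (snd ij) s = 1 /\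
    forall l, (l < n)%nat -> l <> s -> r (fst ij) l * u (snd ij) l = 0))
    as [s' Hs'].
  { intros [i j]; simpl.
    destruct (classic ((i < n)%nat /\ (j < m)%nat)) as [[Hi Hj]|NE].
    - destruct (Hr i Hi) as (_ & R1 & R2).
      destruct (CL_meets_once k n N (r i) (u j)) as [s Hs]; auto.
      + intros l; apply R1.
      + rewrite <- Yu; auto.
      + now exists s.
    - exists O; intros; exfalso; auto. }
  set (s := fun i j => s' (i, j)).
  assert (Hs : forall i j, (i < n)%nat -> (j < m)%nat ->
    (s i j < n)%nat /\ r i (s i j) * u j (s i j) = 1 /\
    forall l, (l < n)%nat -> l <> s i j -> r i l * u j l = 0)
    by (intros i j; exact (Hs' (i, j))).
  clear Hs'; clearbody s; clear s'.
  (* Summing the moduli profiles gives strictly positive weights, because [r l l = 1]; positivity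
     later aligns the phases of all coordinates. *)
  set (c := fun l => rsum (fun i => r i l) n).
  assert (Hc : forall l, (l < n)%nat -> 0 < c l).
  { intros l Hl. assert (r l l <= c l).
    { apply (rsum_term_le (fun i => r i l)); auto. intros i Hi; now apply Hr. }
    destruct (Hr l Hl) as [R0 _]; lra. }
  assert (Sc : forall g, rsum (fun l => c l * g l) n
                         = rsum (fun i => rsum (fun l => r i l * g l) n) n).
  { intros g; rewrite rsum_swap; apply rsum_ext; intros l _.
    rewrite Rmult_comm; unfold c; rewrite <- rsum_scal.
    apply rsum_ext; intros; ring. }
  (* Each profile [r i] pairs to 1 with every [u j], hence to 1 with their average, and there are
     [n] profiles. *)
  assert (Sh : rsum (fun l => c l * h l) n = INR n).
  { rewrite Sc, (rsum_ext _ (fun _ => 1)), rsum_const; [ring|].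
    intros i Hi.
    rewrite (rsum_ext _ (fun l => / INR m * rsum (fun j => r i l * u j l) m)).
    - rewrite rsum_scal, rsum_swap, (rsum_ext _ (fun _ => 1)), rsum_const;
        [field; lra|].
      intros j Hj; destruct (Hs i j Hi Hj) as (S1 & S2 & S3).
      now rewrite (rsum_single _ n (s i j)).
    - intros l _; unfold h; rewrite rsum_scal; ring. }
  set (P := fun i (x : vec k) => Kprodn k (fun j => x (s i j)) m).
  set (T := fun x => pair k n (fun l => Kof k (c l)) x).
  set (Q := fun x => Kadd k (Ksum k (fun i => P i x) n)
                            (Kprodn k (fun _ => T x) m)).
  (* [p i] is the value of the [i]-th monomial at the average, and [M] is the value of [Q] there,
     which will be its norm. *)
  set (p := fun i => rprod (fun j => h (s i j)) m).
  set (M := rsum p n + INR n ^ m).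
  assert (HQ : is_mhomog k n m Q).
  { apply is_mhomog_add.
    - apply is_mhomog_Ksum; intros i Hi; apply is_mhomog_monomial.
      intros j Hj; now apply Hs.
    - apply is_mhomog_linear_pow. }
  (* The functional with coefficients [r i] lies in the dual ball; it is evaluated at the vector of
     moduli of [x], which is in the ball by absoluteness. *)
  assert (Hrx : forall i x, (i < n)%nat -> in_ball k n N x ->
                rsum (fun l => r i l * Kabs k (x l)) n <= 1).
  { intros i x Hi Hx. destruct (Hr i Hi) as (_ & R1 & R2).
    destruct (R2 (fun l => Kof k (r i l))) as [[_ D] _].
    { intros l; apply Kabs_Kof, R1. }
    assert (A := D (vabs k x)).
    unfold vabs in A; rewrite pair_Kof, Kabs_Kof in A.
    - apply A, (in_ball_modulus k n N x); auto.
      intros l; apply Kabs_Kof, Kabs_nonneg.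
    - apply rsum_nonneg; intros; apply Rmult_le_pos; [apply R1 | apply Kabs_nonneg]. }
  (* From the equality case only coordinate [i] is kept, where [r i i = 1] is positive. The [n]
     monomials together recover all coordinates. *)
  assert (HP : forall i x, (i < n)%nat -> in_ball k n N x ->
    Kabs k (P i x) <= p i /\ (Kabs k (P i x) = p i -> Kabs k (x i) = h i)).
  { intros i x Hi Hx. destruct (Hr i Hi) as (R0 & R1 & _).
    unfold P; rewrite Kabs_Kprodn.
    destruct (monomial_max m n u (r i) h (fun l => Kabs k (x l)) (s i))
      as [A B]; auto using Kabs_nonneg.
    split; auto. intros E; apply B; auto; lra. }
  assert (HT : forall x, in_ball k n N x -> Kabs k (T x) <= INR n).
  { intros x Hx. eapply Rle_trans; [apply Kabs_Ksum|].
    rewrite (rsum_ext _ (fun l => c l * Kabs k (x l))).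
    - rewrite Sc, <- (Rmult_1_r (INR n)), <- rsum_const.
      apply rsum_le; auto.
    - intros l Hl; rewrite Kabs_mul, Kabs_Kof; auto; left; auto. }
  assert (HQle : forall x, Kabs k (Q x)
    <= rsum (fun i => Kabs k (P i x)) n + Kabs k (T x) ^ m).
  { intros x; eapply Rle_trans; [apply Kabs_add|].
    rewrite Kabs_Kprodn, rprod_const.
    apply Rplus_le_compat_r, Kabs_Ksum. }
  assert (HTm : forall x, in_ball k n N x -> Kabs k (T x) ^ m <= INR n ^ m).
  { intros x Hx; apply pow_incr; split; [apply Kabs_nonneg | auto]. }
  assert (HPs : forall x, in_ball k n N x ->
            rsum (fun i => Kabs k (P i x)) n <= rsum p n).
  { intros x Hx; apply rsum_le; intros i Hi; now apply HP. }
  assert (Hball : in_ball k n N (vavg k m y)).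
  { apply vavg_in_ball; auto. intros j Hj; now apply Hext. }
  assert (HQy : Q (vavg k m y) = Kof k M).
  { rewrite Yh; unfold Q, P, T, M. rewrite pair_Kof, Sh, Kprodn_Kof, rprod_const.
    rewrite Kof_add, <- Ksum_Kof; f_equal.
    apply Ksum_ext; intros i _; apply (Kprodn_Kof k (fun j => h (s i j))). }
  assert (PM : 0 < M).
  { assert (0 < INR n ^ m) by now apply pow_lt.
    assert (0 <= rsum p n).
    { apply rsum_nonneg; intros; now apply rprod_nonneg. }
    unfold M; lra. }
  (* Reaching [M] makes every estimate tight: the monomials fix the moduli of [x], and the power of
     [T] then fixes the phases up to one common factor. *)
  assert (Hmax : forall x, in_ball k n N x -> Kabs k (Q x) = M ->
    exists lam, Kabs k lam = 1 /\ x = vscal k lam (vavg k m y)).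
  { intros x Hx E.
    assert (A1 := HQle x). assert (A2 := HTm x Hx). assert (A3 := HPs x Hx).
    unfold M in E.
    assert (Hmod : forall l, (l < n)%nat -> Kabs k (x l) = h l).
    { intros l Hl; apply HP; auto.
      apply (rsum_le_eq (fun i => Kabs k (P i x)) p n); auto; [|lra].
      intros i Hi; now apply HP. }
    (* The power is strictly increasing on nonnegative reals because [m] is at least 1. *)
    assert (ET : Kabs k (T x) = INR n).
    { apply Rle_antisym; auto. apply Rnot_lt_le; intros L.
      assert (Kabs k (T x) ^ m < INR n ^ m); [|lra].
      apply pow_strict_incr; auto; split; auto; apply Kabs_nonneg. }
    destruct (triangle_equality k n c h x) as (lam & L1 & L2); auto.
    { lra. }
    { unfold T, pair in ET; rewrite ET; lra. }
    exists lam; split; auto. extensionality l; rewrite Yh; unfold vscal.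
    destruct (Nat.lt_ge_cases l n) as [Hl|Hl]; auto.
    destruct Hx as [X _], Hball as [Xy _]. rewrite (X l Hl).
    rewrite Yh in Xy. rewrite (Xy l Hl). symmetry; apply Kmul_0_r. }
  exists Q; split; auto. split; [|split; auto].
  { exists (vavg k m y); split; [apply Hball|]. rewrite HQy; intros E.
    apply (f_equal (Kabs k)) in E. rewrite Kabs_0, Kabs_Kof in E; lra. }
  exists M; split; [split|].
  - intros v (x & Hx & ->). unfold M.
    assert (A1 := HQle x). assert (A2 := HTm x Hx). assert (A3 := HPs x Hx). lra.
  - intros b Hb; apply Hb; exists (vavg k m y); split; auto.
    rewrite HQy, Kabs_Kof; lra.
  - intros xs Hxs Hcv.
    destruct (vec_bounded_subsequence k n xs 1) as (phi & x & Hphi & Xx & Cx).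
    { intros j; apply Hxs. }
    { intros j l; destruct (Hxs j) as [X B].
      destruct (Nat.lt_ge_cases l n) as [Hl|Hl].
      - apply Rle_trans with (N (xs j)); auto. now apply coord_le_norm with n.
      - rewrite (X l Hl), Kabs_0; lra. }
    assert (Bx : in_ball k n N x)
      by (apply ball_closed with (fun j => xs (phi j)); auto).
    assert (Xs : forall j, inX k n (xs (phi j))) by (intros j; apply Hxs).
    (* By continuity the modulus of [Q] at the limit point equals [M], so this point is a unimodular
       multiple of the average. *)
    destruct (Hmax x Bx) as (lam & L1 & L2).
    { apply (UL_sequence (fun j => Kabs k (Q (xs (phi j))))).
      - apply Kcv_Kabs.
        now apply (is_mhomog_cv k n m Q (fun j => xs (phi j)) x).
      - now apply (Un_cv_subseq (fun j => Kabs k (Q (xs j)))). }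
    exists lam, phi; repeat split; auto.
    rewrite <- L2. now apply (norm_cv k n N (fun j => xs (phi j)) x).
Qed.
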